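(* Let $0<\alpha<1$, $\varepsilon>0$, and let $0=t_0<t_1<\cdots<t_N=T$ be an arbitrary time grid with steps $\tau_k=t_k-t_{k-1}$. Let $u^0,\dots,u^N\in\mathbb{R}^{M}$ and $v^{\frac12},\dots,v^{N-\frac12}\in\mathbb{R}^{M}$ be a solution of the Crank-Nicolson scheme $$\frac{u^n-u^{n-1}}{\tau_n}=\frac1{\tau_n}\sum_{k=1}^{n}a_{n-k}^{(n)}v^{k-\frac12},\qquad v^{n-\frac12}=\varepsilon^2D_h\,\frac{u^n+u^{n-1}}{2}-H(u^n,u^{n-1}),\qquad 1\le n\le N.$$ Then the discrete variational energy dissipation law holds unconditionally (with no restriction on the time steps): $$\frac{\mathcal{E}_\alpha[u^n]-\mathcal{E}_\alpha[u^{n-1}]}{\tau_n}+\frac{1}{2\tau_n}\int_{t_{n-1}}^{t_n}\omega_\alpha(s)\,\mathrm{d}s\;\sum_{i,j=1}^{M_1}h^2\big(v_{ij}^{n-\frac12}\big)^2\le 0\qquad\text{for }1\le n\le N.$$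
   Context: Notation. For $\mu>0$, $\omega_\mu(t)=t^{\mu-1}/\Gamma(\mu)$ for $t>0$. Empty sums ($\sum_{k=i}^{j}$ with $i>j$) are $0$. Kernels: for $1\le k\le n$, $q_{n-k}^{(n)}=\int_{t_{k-1}}^{t_k}\omega_\alpha(t_n-s)\,\mathrm{d}s$; $a_0^{(n)}=q_0^{(n)}$ for $n\ge1$, and $a_{n-k}^{(n)}=q_{n-k}^{(n)}-q_{n-k-1}^{(n-1)}$ for $n\ge k+1\ge2$. Space grid: $\Omega=(0,L)^2$ with periodic boundary conditions, $M_1$ a positive integer, $h=L/M_1$, $M=M_1^2$. Grid functions $w=(w_{ij})_{1\le i,j\le M_1}$ are identified with vectors in $\mathbb{R}^M$. $D_h$ is the $M\times M$ matrix of the standard second-order (five-point) central difference discretization of the Laplacian with periodic boundary conditions: $(D_hw)_{ij}=h^{-2}(w_{i+1,j}+w_{i-1,j}+w_{i,j+1}+w_{i,j-1}-4w_{ij})$, indices taken modulo $M_1$. Nonlinear term: $H$ acts entrywise on vectors via $H(a,b)=\frac13a^3+\frac12ab^2+\frac16b^3-\frac12(a+b)$ for real $a,b$. Energies: $F(u)=\frac14(1-u^2)^2$, $$E[u^n]=h^2\sum_{i,j=1}^{M_1}F(u_{ij}^n)-\frac12\varepsilon^2h^2(u^n)^TD_hu^n,\qquad \mathcal{E}_\alpha[u^n]=E[u^n]+\frac12h^2\sum_{i,j=1}^{M_1}\sum_{k=1}^{n}q_{n-k}^{(n)}\big(v_{ij}^{k-\frac12}\big)^2\quad(0\le n\le N),$$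 so that $\mathcal{E}_\alpha[u^0]=E[u^0]$. *)

(* Defs.v *)
From HB Require Import structures.
From mathcomp Require Import all_boot all_order all_algebra.
From mathcomp Require Import all_classical all_reals all_analysis.
From mathcomp Require Import ring.

Set Implicit Arguments.
Unset Strict Implicit.
Unset Printing Implicit Defensive.
Import Order.TTheory GRing.Theory Num.Theory.
Import numFieldNormedType.Exports.

Local Open Scope classical_set_scope.
Local Open Scope ring_scope.

Section Kernels.
Context {R : realType}.
Implicit Types (alpha mu x : R) (t : nat -> R) (n j : nat).

(* Euler's Gamma function; the integral converges only for 0 < mu. *)
Definition Gamma mu : R :=
  \int[lebesgue_measure]_(x in `]0, +oo[) (x `^ (mu - 1) * expR (- x)).

(* Meaningful for x > 0; when mu != 1, [powR] makes the value at x = 0 equal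
   to 0, on which the integrals below do not depend. *)
Definition omega mu x : R := x `^ (mu - 1) / Gamma mu.

Definition tau t n : R := t n - t n.-1.

(* [q alpha t n j] is q_j^{(n)}: the integral is over [t_{k-1}, t_k] with
   k = n - j; it is only used for j < n. *)
Definition q alpha t n j : R :=
  \int[lebesgue_measure]_(s in `[t (n - j).-1, t (n - j)%N])
    omega alpha (t n - s).

(* [a alpha t n j] is a_j^{(n)}, again for j < n. *)
Definition a alpha t n j : R :=
  if j == 0%N then q alpha t n 0 else q alpha t n j - q alpha t n.-1 j.-1.

End Kernels.

Section Space.
Context {R : realType}.

Definition mesh (L : R) (M : nat) : R := L / M%:R.

(* A grid function on the M x M grid is a vector of length M * M, enumerated
   by [mxvec_index]. *)
Definition at_grid (M : nat) (w : 'cV[R]_(M * M)) (i j : 'I_M) : R :=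
  w (mxvec_index i j) 0.

(* [ordS] and [ord_pred] are successor and predecessor modulo M. *)
Definition stencil (h : R) (M : nat) (w : 'M[R]_M) : 'M[R]_M :=
  \matrix_(i, j) (h ^- 2 * (w (ordS i) j + w (ord_pred i) j
                            + w i (ordS j) + w i (ord_pred j) - 4 * w i j)).

Fact stencil_is_linear h M : linear (@stencil h M).
Proof.
by move=> c x y; apply/matrixP => i j; rewrite !mxE; ring.
Qed.
HB.instance Definition _ h M :=
  GRing.isLinear.Build R 'M[R]_M 'M[R]_M *:%R (@stencil h M)
    (@stencil_is_linear h M).

(* [lin_mx] acts on row vectors from the right, hence the transpose. *)
Definition Dh (L : R) (M : nat) : 'M[R]_(M * M) :=
  (lin_mx (@stencil (mesh L M) M))^T.

Lemma DhE L M (w : 'cV[R]_(M * M)) (i j : 'I_M) :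
  at_grid (Dh L M *m w) i j =
  mesh L M ^- 2 * (at_grid w (ordS i) j + at_grid w (ord_pred i) j
                   + at_grid w i (ordS j) + at_grid w i (ord_pred j)
                   - 4 * at_grid w i j).
Proof.
rewrite /at_grid /Dh -[in LHS](trmxK w) -trmx_mul mxE -[w^T]vec_mxK.
by rewrite mul_vec_lin mxvecE !mxE.
Qed.

Definition H (x y : R) : R :=
  x ^+ 3 / 3 + x * y ^+ 2 / 2 + y ^+ 3 / 6 - (x + y) / 2.

Definition F (x : R) : R := (1 - x ^+ 2) ^+ 2 / 4.

Definition energy (eps L : R) (M : nat) (w : 'cV[R]_(M * M)) : R :=
  mesh L M ^+ 2 * (\sum_(i < M) \sum_(j < M) F (at_grid w i j))
  - 2^-1 * eps ^+ 2 * mesh L M ^+ 2 * (w^T *m Dh L M *m w) 0 0.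

(* [v k] is v^{k-1/2}. *)
Definition energy_alpha (alpha eps L : R) (M : nat) (t : nat -> R)
    (u v : nat -> 'cV[R]_(M * M)) (n : nat) : R :=
  energy eps L (u n)
  + 2^-1 * mesh L M ^+ 2 *
    \sum_(i < M) \sum_(j < M) \sum_(1 <= k < n.+1)
      q alpha t n (n - k) * at_grid (v k) i j ^+ 2.

End Space.

(* Main.v *)
Require Import Defs.
From mathcomp Require Import all_boot all_order all_algebra.
From mathcomp Require Import all_classical all_reals all_analysis.
From mathcomp Require Import measurable_realfun ring lra.
Set Implicit Arguments.
Unset Strict Implicit.
Unset Printing Implicit Defensive.
Import Order.TTheory GRing.Theory Num.Theory.
Import numFieldNormedType.Exports.
Local Open Scope classical_set_scope.
Local Open Scope ring_scope.

(** Two facts make the energy decrease.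

    Local part. The nonlinearity [H x y] is chosen so that
    [F x - F y = (x - y) * H x y - (x - y) ^+ 4 / 12] ([F_secant]), and the
    discrete Laplacian is symmetric ([Dh_form_sym]), so the change of the
    quadratic part of the energy is a multiple of the form of [Dh] between the
    difference and the sum of the two levels. Together with the second
    equation of the scheme, this bounds the increment of the energy by minus
    the pairing of [u n - u n.-1] with [v n] ([energy_increment]). The first
    equation turns this pairing into the kernel quadratic form: [v n] times
    the sum of the [a_(n-k) * v k].

    Nonlocal part. Bounding the history is a statement about real sequences
    ([kernel_bound]). For [k < n] the weight [a_(n-k)], the difference of the
    weights of [v k] at times [t n] and [t n.-1], is nonpositive, because
    [omega alpha] decreases. Hence
    [2 * v n * a_(n-k) * v k >= a_(n-k) * (v n ^+ 2 + v k ^+ 2)]. The terms in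
    [v k ^+ 2] reproduce the change of the nonlocal energy. The coefficient of
    [v n ^+ 2] involves only the total masses of the weights at two successive
    times, which are the integrals of [omega alpha] from [0] to [t n] and from
    [0] to [t n.-1]; their difference is the integral in the dissipation term.

    Both properties of the weights are read off the primitive [Omega alpha] of
    [omega alpha]: a weight is an increment of [Omega alpha], so the masses
    telescope ([kernel_sum]) and monotonicity is concavity of [Omega alpha]
    ([Omega_increment_nincr]). Since [omega alpha] is unbounded at [0], the
    formula for the weights requires a fundamental theorem of calculus that
    does not ask the integrand to be continuous at the endpoints
    ([ge0_open_continuous_FTC2]). *)

(** * A fundamental theorem of calculus for improper integrands *)

(** The integrand may blow up at the endpoints: the usual theorem applies on the
    compact intervals [S n] exhausting the open interval, nonnegativity lets
    the integrals pass to the limit, and continuity of [G] up to the endpoints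
    identifies that limit. *)
Lemma ge0_open_continuous_FTC2 (R : realType) (f G : R -> R) (a b : R) :
  a < b ->
  (forall x, x \in `]a, b[ -> 0 <= f x) ->
  {in `]a, b[, continuous f} ->
  (forall x, x \in `]a, b[ -> is_derive x 1 G (f x)) ->
  {within `[a, b], continuous G} ->
  \int[lebesgue_measure]_(x in `[a, b]) f x = G b - G a.
Proof.
move=> ab f_ge0 fc dG /(continuous_within_itvP _ ab)[Gc Ga Gb].
have mf : measurable_fun `]a, b[ f.
  apply: open_continuous_measurable_fun => //.
  exact/in_continuous_mksetP.
(* The factor 1/3 keeps [a + h n < b - h n] already for [n = 0]. *)
pose h (n : nat) : R := (b - a) / 3 * harmonic n.
have h_gt0 n : 0 < h n.
  by rewrite mulr_gt0 ?harmonic_gt0// divr_gt0 ?subr_gt0.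
have h_le n : h n <= (b - a) / 3.
  rewrite ger_pMr ?divr_gt0 ?subr_gt0// invf_le1 ?ltr0n//.
  by rewrite ler1n.
have h_decr m n : (m <= n)%N -> h n <= h m.
  move=> mn; rewrite ler_pM2l ?divr_gt0 ?subr_gt0//.
  by rewrite lef_pV2 ?posrE ?ltr0n// ler_nat ltnS.
have h_cvg : h n @[n --> \oo] --> (0 : R).
  by rewrite -(mulr0 ((b - a) / 3)); apply: cvgMr; exact: cvg_harmonic.
pose S n : set R := `[a + h n, b - h n]%classic.
have SE : \bigcup_n S n = `]a, b[%classic.
  apply/seteqP; split=> x /=.
    move=> [n _]; rewrite /S /= !in_itv/= => /andP[ax xb].
    by have hn := h_gt0 n; apply/andP; split; lra.
  rewrite in_itv/= => /andP[ax xb].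
  have d0 : 0 < Num.min (x - a) (b - x) by rewrite lt_min !subr_gt0 ax xb.
  have [n _ /(_ n (leqnn n))] := cvgr_lt 0 h_cvg _ d0.
  rewrite /= lt_min => /andP[hx hb]; exists n => //.
  by rewrite /S /= in_itv/=; apply/andP; split; lra.
have Soo n : S n `<=` `]a, b[ by rewrite -SE; exact: bigcup_sup.
have step n : (\int[lebesgue_measure]_(x in S n) (f x)%:E
    = (G (b - h n) - G (a + h n))%:E)%E.
  have oo x : x \in `[(a + h n), (b - h n)] -> x \in `]a, b[ by exact: Soo.
  have oo' x : x \in `](a + h n), (b - h n)[ -> x \in `]a, b[.
    by move=> xn; apply: oo; exact: subset_itv_oo_cc.
  have lt_n : a + h n < b - h n by have := h_le n; lra.
  have Gw : {within `[a + h n, b - h n], continuous G}.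
    apply: derivable_within_continuous => x /oo xn.
    by have [] := dG x xn.
  rewrite EFinB /S; apply: continuous_FTC2 => //.
  - apply: continuous_in_subspaceT => x; rewrite inE => xn; apply: fc.
    exact: oo.
  - have [_ Gl Gr] := (continuous_within_itvP _ lt_n).1 Gw.
    by split=> // x /oo' xn; have [] := dG x xn.
  - move=> x /oo' xn; rewrite derive1E.
    by have := dG x xn => ?; rewrite derive_val.
have /measurable_EFinP mfE := mf.
rewrite /Rintegral (integral_itv_bndoo (f := EFin \o f))// -SE.
have mS n := measurable_funS (measurable_itv _) (Soo n) mfE.
have nS : nondecreasing_seq S.
  move=> m n mn; rewrite subsetEset => x; rewrite /S/= !in_itv/= => /andP[? ?].
  by have hmn := h_decr _ _ mn; apply/andP; split; lra.
have S_ge0 n x : S n x -> (0 <= (EFin \o f) x)%E.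
  by move=> Snx; rewrite lee_fin; apply: f_ge0; exact: (Soo n).
have lim1 := ge0_nondecreasing_set_cvg_integral
  (mu := lebesgue_measure) nS (fun n => measurable_itv _) mS S_ge0.
have lim2 : (G (b - h n) - G (a + h n))%:E @[n --> \oo] --> (G b - G a)%:E.
  apply: cvg_EFin; first exact: nearW.
  apply: cvgB.
    apply: (cvg_at_leftP G b (G b)).1 => //; split.
      by move=> n; rewrite ltrBlDr ltrDl.
    by rewrite -[X in _ --> X]subr0; apply: cvgB => //; exact: cvg_cst.
  apply: (cvg_at_rightP G a (G a)).1 => //; split.
    by move=> n; rewrite ltrDl.
  by rewrite -[X in _ --> X]addr0; apply: cvgD => //; exact: cvg_cst.
rewrite -[RHS]/(fine (G b - G a)%:E); congr fine.
apply: (cvg_unique _ lim1) => //.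
apply: cvg_trans lim2; apply: near_eq_cvg; apply: nearW => n.
by rewrite -step.
Qed.

(** * The kernel and its primitive *)

(** The real-valued integral of a nonnegative function is nonnegative whether or
    not it converges, so this holds for every [mu]. *)
Lemma Gamma_ge0 (R : realType) (mu : R) : 0 <= Gamma mu.
Proof.
by apply: Rintegral_ge0 => x _; rewrite mulr_ge0 ?powR_ge0 ?expR_ge0.
Qed.

Lemma omega_ge0 (R : realType) (mu x : R) : 0 <= omega mu x.
Proof. by rewrite divr_ge0 ?powR_ge0 ?Gamma_ge0. Qed.

Lemma omega_nincr (R : realType) (mu x y : R) :
  mu <= 1 -> 0 < x -> x <= y -> omega mu y <= omega mu x.
Proof.
move=> mu1 x0 xy; have y0 := lt_le_trans x0 xy.
rewrite ler_wpM2r ?invr_ge0 ?Gamma_ge0//.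
rewrite -(opprB 1 mu) !powRN lef_pV2 ?posrE ?powR_gt0//.
by apply: ge0_ler_powR; rewrite ?subr_ge0// nnegrE ltW.
Qed.

(** This is the kernel of order [mu + 1]; writing [mu * Gamma mu] for
    [Gamma (mu + 1)] makes it a primitive of [omega mu] without appeal to the
    functional equation of Gamma. *)
Definition Omega {R : realType} (mu x : R) : R := x `^ mu / (mu * Gamma mu).

Lemma is_derive_Omega (R : realType) (mu x : R) : 0 < mu -> 0 < x ->
  is_derive x 1 (Omega mu) (omega mu x).
Proof.
move=> mu0 x0; rewrite /Omega /omega.
rewrite (_ : (fun _ => _) = (mu * Gamma mu)^-1 *: (@powR R)^~ mu); last first.
  by apply/funext => z; rewrite /= mulrC.
apply: (is_derive_eq (is_deriveZ _ (is_derive1_powR mu x0))).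
(* Abstracting the inverse spares [field] the side condition [Gamma mu != 0]. *)
rewrite /GRing.scale/= invfM; set g := (Gamma mu)^-1.
by field; rewrite gt_eqF.
Qed.

(** The sequence is kept in the open half-line, but its limit may be [0]: this
    is the continuity of [Omega mu] up to the singularity of [omega mu]. *)
Lemma cvg_Omega (R : realType) (mu : R) (w : nat -> R) (y : R) :
  0 < mu -> (forall n, 0 < w n) -> w n @[n --> \oo] --> y ->
  Omega mu (w n) @[n --> \oo] --> Omega mu y.
Proof.
move=> mu0 w0 wy; apply: cvgMl.
have y0 : 0 <= y.
  rewrite -(cvg_lim _ wy)//; apply: limr_ge; first by apply/cvg_ex; exists y.
  by apply: nearW => n; exact: ltW.
have [yE|yN0] := eqVneq y 0.
  rewrite yE powR0 ?gt_eqF//; rewrite yE in wy.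
  apply: (cvg_at_rightP (fun z : R => z `^ mu) 0 0).1 => //.
  exact: powR_cvg0.
have yp : 0 < y by rewrite lt0r yN0.
suff cy : {for y, continuous (fun z : R => z `^ mu)}.
  exact: (continuous_cvg _ cy wy).
apply: differentiable_continuous; apply/derivable1_diffP.
by apply: derivable_powR; rewrite in_itv/= yp.
Qed.

Lemma continuous_Omega (R : realType) (mu x : R) :
  0 < mu -> 0 < x -> {for x, continuous (Omega mu)}.
Proof.
move=> mu0 x0; apply: differentiable_continuous; apply/derivable1_diffP.
by have [] := is_derive_Omega mu0 x0.
Qed.

Lemma within_continuous_Omega (R : realType) (mu a b : R) :
  0 < mu -> 0 <= a -> a < b -> {within `[a, b], continuous (Omega mu)}.
Proof.
move=> mu0 a0 ab; apply/(continuous_within_itvP _ ab); split.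
- move=> x; rewrite in_itv/= => /andP[ax _].
  by apply: continuous_Omega => //; exact: le_lt_trans ax.
- apply/cvg_at_rightP => w [aw wa]; apply: cvg_Omega => // n.
  exact: le_lt_trans (aw n).
- apply: cvg_at_left_filter; apply: continuous_Omega => //.
  exact: le_lt_trans ab.
Qed.

Lemma within_continuous_Omega_refl (R : realType) (mu a b c : R) :
  0 < mu -> a < b -> b <= c ->
  {within `[a, b], continuous (fun s => Omega mu (c - s))}.
Proof.
move=> mu0 ab bc.
have cont x : x < c -> {for x, continuous (fun s => Omega mu (c - s))}.
  move=> xc; apply: (continuous_comp (f := fun s => c - s)).
    by apply: cvgB; [exact: cvg_cst | exact: cvg_id].
  by apply: continuous_Omega => //; rewrite subr_gt0.
apply/(continuous_within_itvP _ ab); split.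
- move=> x; rewrite in_itv/= => /andP[_ xb].
  by apply: cont; exact: lt_le_trans bc.
- by apply: cvg_at_right_filter; apply: cont; exact: lt_le_trans bc.
- apply/cvg_at_leftP => w [wb wcvg].
  apply: (cvg_Omega (w := fun n => c - w n)) => //.
    by move=> n; rewrite subr_gt0; exact: lt_le_trans bc.
  by apply: cvgB => //; exact: cvg_cst.
Qed.

Lemma continuous_omega (R : realType) (mu x : R) :
  0 < x -> {for x, continuous (omega mu)}.
Proof.
move=> x0; apply: differentiable_continuous; apply/derivable1_diffP.
apply: derivableM => //; apply: derivable_powR.
by rewrite in_itv/= x0.
Qed.

Lemma Rintegral_omega (R : realType) (mu a b : R) :
  0 < mu -> 0 <= a -> a < b ->
  \int[lebesgue_measure]_(s in `[a, b]) omega mu s = Omega mu b - Omega mu a.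
Proof.
move=> mu0 a0 ab.
have pos x : x \in `]a, b[ -> 0 < x.
  by rewrite in_itv/= => /andP[+ _]; exact: le_lt_trans.
apply: ge0_open_continuous_FTC2 => //.
- by move=> x _; exact: omega_ge0.
- by move=> x /pos; exact: continuous_omega.
- by move=> x /pos; exact: is_derive_Omega.
- exact: within_continuous_Omega.
Qed.

Lemma Rintegral_omega_refl (R : realType) (mu a b c : R) :
  0 < mu -> a < b -> b <= c ->
  \int[lebesgue_measure]_(s in `[a, b]) omega mu (c - s)
    = Omega mu (c - a) - Omega mu (c - b).
Proof.
move=> mu0 ab bc.
have pos x : x \in `]a, b[ -> 0 < c - x.
  by rewrite in_itv/= subr_gt0 => /andP[_ xb]; exact: lt_le_trans bc.
rewrite -[RHS]opprB opprD.
apply: (ge0_open_continuous_FTC2 (G := fun s => - Omega mu (c - s))) => //.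
- by move=> x _; exact: omega_ge0.
- move=> x /pos xc; apply: (continuous_comp (f := fun s => c - s)).
    by apply: cvgB; [exact: cvg_cst | exact: cvg_id].
  exact: continuous_omega.
- move=> x /pos xc.
  have dO := is_derive_Omega mu0 xc.
  have dc : is_derive x 1 (fun s : R => c - s) (-1).
    have dcx := is_deriveB (is_derive_cst c x 1) (is_derive_id x 1).
    by apply: (is_derive_eq dcx); rewrite sub0r.
  rewrite (_ : (fun s => _) = - (Omega mu \o (fun s => c - s)))//.
  have dOc := is_deriveN (is_derive1_comp (g := fun s => c - s) dO dc).
  apply: (is_derive_eq dOc).
  by rewrite mulrN1 opprK.
- have cO := within_continuous_Omega_refl mu0 ab bc.
  have [c1 c2 c3] := (continuous_within_itvP _ ab).1 cO.
  apply/(continuous_within_itvP _ ab).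
  by split; [move=> x /c1; exact: cvgN | exact: cvgN | exact: cvgN].
Qed.

(** Concavity of [Omega mu]: the derivative in [z] of
    [Omega mu z - Omega mu (z + d)] is [omega mu z - omega mu (z + d)],
    nonnegative for [mu <= 1]. *)
Lemma Omega_increment_nincr (R : realType) (mu x y d : R) :
  0 < mu -> mu <= 1 -> 0 <= x -> x <= y -> 0 <= d ->
  Omega mu (y + d) - Omega mu y <= Omega mu (x + d) - Omega mu x.
Proof.
move=> mu0 mu1 x0 xy; rewrite le_eqVlt => /predU1P[<-|d0].
  by rewrite !addr0 !subrr.
have [->//|xNy] := eqVneq x y.
have {xNy}xy' : x < y by rewrite lt_neqAle xNy.
pose g := Omega mu - (Omega mu \o (fun s => s + d)).
rewrite -lerN2 !opprB.
suff : g x <= g y by [].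
have dg z : z \in `]x, y[ -> is_derive z 1 g (omega mu z - omega mu (z + d)).
  rewrite in_itv/= => /andP[xz _]; have z0 := le_lt_trans x0 xz.
  have dO := is_derive_Omega mu0 (addr_gt0 z0 d0).
  have ds : is_derive z 1 (fun s : R => s + d) 1.
    have dzd := is_deriveD (is_derive_id z 1) (is_derive_cst d z 1).
    by apply: (is_derive_eq dzd); rewrite addr0.
  have dO' := is_derive_Omega mu0 z0.
  have dOd := is_deriveB dO' (is_derive1_comp (g := fun s => s + d) dO ds).
  apply: (is_derive_eq dOd).
  by rewrite mulr1.
apply: (ger0_derive1_ndecr (a := x) (b := y)) => //.
- by move=> z /dg [].
- move=> z zxy; have dgz := dg z zxy; rewrite derive1E derive_val subr_ge0.
  apply: omega_nincr => //; last by rewrite lerDl ltW.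
  by move: zxy; rewrite in_itv/= => /andP[xz _]; exact: le_lt_trans xz.
- move=> z; apply: continuousB; first exact: within_continuous_Omega.
  apply: continuous_in_subspaceT => {}z; rewrite inE/= in_itv/= => /andP[xz _].
  apply: (continuous_comp (f := fun s => s + d)).
    by apply: cvgD; [exact: cvg_id | exact: cvg_cst].
  by apply: continuous_Omega => //; rewrite ltr_wpDl// (le_trans x0).
Qed.

(** * The nonlocal term *)

Lemma q_Omega (R : realType) (alpha : R) (t : nat -> R) (n k : nat) :
  0 < alpha -> (0 < k <= n)%N -> t k.-1 < t k -> t k <= t n ->
  q alpha t n (n - k) = Omega alpha (t n - t k.-1) - Omega alpha (t n - t k).
Proof.
by move=> alpha0 /andP[k0 kn] tk tkn; rewrite /q subKn// Rintegral_omega_refl.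
Qed.

(** Completing squares: the right-hand side minus the left-hand side is the sum
    over [k <= n] of [(r k - p k) * (z k - z n.+1) ^+ 2]. The hypothesis on
    total masses is what makes the coefficients of [z n.+1 ^+ 2] match. *)
Lemma quadratic_kernel_bound (R : realFieldType) (n : nat) (p r z : nat -> R)
    (c : R) :
  (forall k, (0 < k <= n)%N -> p k <= r k) ->
  \sum_(1 <= k < n.+2) p k - \sum_(1 <= k < n.+1) r k = c ->
  \sum_(1 <= k < n.+2) p k * z k ^+ 2 - \sum_(1 <= k < n.+1) r k * z k ^+ 2
    + c * z n.+1 ^+ 2
  <= 2 * z n.+1 * (\sum_(1 <= k < n.+1) (p k - r k) * z k + p n.+1 * z n.+1).
Proof.
move=> pr <-; rewrite !(big_nat_recr n.+1)//= -subr_ge0.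
set y := z n.+1.
have -> : \sum_(1 <= k < n.+1) (p k - r k) * z k =
   \sum_(1 <= k < n.+1) (p k * z k) - \sum_(1 <= k < n.+1) r k * z k.
  by rewrite -sumrB; apply: eq_bigr => k _; rewrite mulrBl.
have : 0 <= \sum_(1 <= k < n.+1) (r k - p k) * (z k - y) ^+ 2.
  rewrite big_nat; apply: sumr_ge0 => k /andP[k0 kn].
  by rewrite mulr_ge0 ?sqr_ge0// subr_ge0 pr// k0.
have -> : \sum_(1 <= k < n.+1) (r k - p k) * (z k - y) ^+ 2 =
    \sum_(1 <= k < n.+1) r k * z k ^+ 2 - \sum_(1 <= k < n.+1) p k * z k ^+ 2
    + 2 * y * (\sum_(1 <= k < n.+1) p k * z k - \sum_(1 <= k < n.+1) r k * z k)
    + y ^+ 2 * (\sum_(1 <= k < n.+1) r k - \sum_(1 <= k < n.+1) p k).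
  rewrite -!sumrB !mulr_sumr -!big_split/=; apply: eq_bigr => k _; ring.
move=> sq_ge0; apply: le_trans sq_ge0 _.
by rewrite le_eqVlt; apply/predU1P; left; ring.
Qed.

Section Weights.
Context {R : realType} (alpha : R) (t : nat -> R) (N : nat).
Context (alpha_gt0 : 0 < alpha) (alpha_lt1 : alpha < 1) (t0 : t 0%N = 0).
Context (t_incr : forall k : nat, (1 <= k <= N)%N -> t k.-1 < t k).

Lemma time_grid_le m n : (m <= n <= N)%N -> t m <= t n.
Proof.
move=> /andP[mn nN]; elim: n mn nN => [|n IHn].
  by rewrite leqn0 => /eqP->.
rewrite leq_eqVlt => /predU1P[->//|mn nN].
exact: le_trans (IHn mn (ltnW nN)) (ltW (@t_incr n.+1 nN)).
Qed.

(** The weights partition the integral of [omega alpha (t n - s)] over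
    [`[0, t n]]. *)
Lemma kernel_sum n : (n <= N)%N ->
  \sum_(1 <= k < n.+1) q alpha t n (n - k) = Omega alpha (t n).
Proof.
move=> nN.
have -> : \sum_(1 <= k < n.+1) q alpha t n (n - k) =
    \sum_(1 <= k < n.+1)
      (- Omega alpha (t n - t k) - - Omega alpha (t n - t k.-1)).
  apply: eq_big_nat => k /andP[k0 /ltnSE kn]; rewrite opprK addrC q_Omega//.
  - by rewrite k0.
  - by rewrite t_incr// k0 (leq_trans kn).
  - by rewrite time_grid_le// kn.
rewrite big_add1/= telescope_sumr// t0 subr0 subrr opprK.
by rewrite /Omega powR0 ?gt_eqF// mul0r oppr0 add0r.
Qed.

(** The weight of a fixed past interval decreases as the current time advances,
    that is, [a] is nonpositive off the diagonal: both weights are increments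
    of [Omega alpha] of the same length, the one at the later time lying
    further to the right. *)
Lemma q_nincr n k : (0 < k <= n)%N -> (n < N)%N ->
  q alpha t n.+1 (n.+1 - k) <= q alpha t n (n - k).
Proof.
move=> /andP[k0 kn] nN.
have tk : t k.-1 < t k by rewrite t_incr// k0 (leq_trans kn)// ltnW.
have tkn : t k <= t n by rewrite time_grid_le// kn ltnW.
have tn : t n <= t n.+1 by rewrite time_grid_le// leqnSn.
rewrite !q_Omega// ?k0 ?(leq_trans kn)// ?(le_trans tkn)//.
have := @Omega_increment_nincr _ alpha (t n - t k) (t n.+1 - t k)
  (t k - t k.-1) alpha_gt0 (ltW alpha_lt1).
by rewrite !subrKA; apply; lra.
Qed.

(** The total masses at [t n.+1] and [t n] differ by the integral of
    [omega alpha] over the last step, whence the dissipation term. *)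
Lemma kernel_bound n (z : nat -> R) : (n < N)%N ->
  \sum_(1 <= k < n.+2) q alpha t n.+1 (n.+1 - k) * z k ^+ 2
    - \sum_(1 <= k < n.+1) q alpha t n (n - k) * z k ^+ 2
    + (\int[lebesgue_measure]_(s in `[t n, t n.+1]) omega alpha s) * z n.+1 ^+ 2
  <= 2 * z n.+1 * \sum_(1 <= k < n.+2) a alpha t n.+1 (n.+1 - k) * z k.
Proof.
move=> nN.
have -> : \sum_(1 <= k < n.+2) a alpha t n.+1 (n.+1 - k) * z k =
    \sum_(1 <= k < n.+1) (q alpha t n.+1 (n.+1 - k) - q alpha t n (n - k)) * z k
    + q alpha t n.+1 (n.+1 - n.+1) * z n.+1.
  rewrite big_nat_recr//=; congr (_ + _); last by rewrite subnn.
  by apply: eq_big_nat => k /andP[_ kn]; rewrite /a subSn.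
apply: quadratic_kernel_bound.
  by move=> k kn; exact: q_nincr.
rewrite !kernel_sum ?(ltnW nN)// Rintegral_omega//.
- by rewrite -t0 time_grid_le//= ltnW.
- exact: (@t_incr n.+1 nN).
Qed.

End Weights.

(** * The local energy *)

Lemma sum_mxvec_index (R : realType) (M : nat) (f : 'I_(M * M) -> R) :
  \sum_k f k = \sum_(i < M) \sum_(j < M) f (mxvec_index i j).
Proof.
rewrite pair_bigA (reindex (uncurry (@mxvec_index M M))) /=; last first.
  exact: curry_mxvec_bij.
by apply: eq_bigr => -[i j].
Qed.

Lemma grid_dotE (R : realType) (M : nat) (x y : 'cV[R]_(M * M)) :
  (x^T *m y) 0 0 = \sum_(i < M) \sum_(j < M) at_grid x i j * at_grid y i j.
Proof.
by rewrite mxE sum_mxvec_index; do 2!apply: eq_bigr => ? _; rewrite mxE.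
Qed.

(** Summation by parts on the torus: moving a shift of the second vector onto
    the first one turns it into the opposite shift, and the stencil contains
    each shift together with its opposite. *)
Lemma Dh_form_sym (R : realType) (L : R) (M : nat) (x y : 'cV[R]_(M * M)) :
  (x^T *m (Dh L M *m y)) 0 0 = (y^T *m (Dh L M *m x)) 0 0.
Proof.
(* [S s r a b] pairs [a] with the translate of [b] by [s] and [r]. *)
pose S (s : 'I_M -> 'I_M) (r : 'I_M -> 'I_M) (a b : 'cV[R]_(M * M)) :=
  \sum_(p : 'I_M * 'I_M) at_grid a p.1 p.2 * at_grid b (s p.1) (r p.2).
have expand a b : (a^T *m (Dh L M *m b)) 0 0 = mesh L M ^- 2 *
    (S (@ordS M) id a b + S (@ord_pred M) id a b + S id (@ordS M) a b
     + S id (@ord_pred M) a b - 4 * S id id a b).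
  rewrite grid_dotE pair_bigA /S !mulr_sumr -!big_split -sumrB mulr_sumr /=.
  by apply: eq_bigr => p _; rewrite DhE; ring.
have shift s s' r r' a b : cancel s s' -> cancel s' s -> cancel r r' ->
    cancel r' r -> S s r a b = S s' r' b a.
  move=> sK s'K rK r'K; rewrite /S (reindex (fun p => (s' p.1, r' p.2))) /=.
    by apply: eq_bigr => p _; rewrite s'K r'K mulrC.
  by exists (fun p => (s p.1, r p.2)) => -[i j] _ /=; rewrite ?sK ?s'K ?rK ?r'K.
rewrite !expand; congr (_ * (_ - 4 * _)); last exact: shift.
rewrite (shift _ (@ord_pred M) _ id x y)
  ?(shift (@ord_pred M) (@ordS M) _ id x y);
  try by [exact: ordSK | exact: ord_predK |].
rewrite (shift _ id _ (@ord_pred M) x y)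
  ?(shift _ id (@ord_pred M) (@ordS M) x y);
  try by [exact: ordSK | exact: ord_predK |].
ring.
Qed.

Lemma F_secant (R : realType) (x y : R) : F x - F y <= (x - y) * H x y.
Proof.
have -> : F x - F y = (x - y) * H x y - (x - y) ^+ 4 / 12.
  by rewrite /F /H; field.
by rewrite gerBl divr_ge0// exprn_even_ge0.
Qed.

(** By symmetry of [Dh], the difference of its quadratic forms at [x] and [y] is
    its bilinear form between [x - y] and [x + y], which is where averaging
    the two levels in the scheme makes it exact; only [F_secant] loses
    anything. *)
Lemma energy_increment (R : realType) (eps L : R) (M : nat)
    (x y w : 'cV[R]_(M * M)) :
  w = eps ^+ 2 *: (Dh L M *m (2^-1 *: (x + y))) - map2_mx H x y ->
  energy eps L x - energy eps L y <=
  - (mesh L M ^+ 2 *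
     \sum_(i < M) \sum_(j < M) at_grid (x - y) i j * at_grid w i j).
Proof.
move=> wE.
set h2 := mesh L M ^+ 2.
have h2_ge0 : 0 <= h2 by exact: sqr_ge0.
have quad : (x^T *m Dh L M *m x) 0 0 - (y^T *m Dh L M *m y) 0 0 =
    ((x - y)^T *m (Dh L M *m (x + y))) 0 0.
  have addE (a b : 'M[R]_1) : (a + b) 0 0 = a 0 0 + b 0 0 by rewrite mxE.
  have oppE (a : 'M[R]_1) : (- a) 0 0 = - a 0 0 by rewrite mxE.
  rewrite mulmxDr linearB/= mulmxDr !mulmxBl !(addE, oppE).
  rewrite (Dh_form_sym L y x) !mulmxA.
  ring.
have quad_w : eps ^+ 2 * ((x - y)^T *m (Dh L M *m (x + y))) 0 0 =
    2 * ((x - y)^T *m (w + map2_mx H x y)) 0 0.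
  rewrite wE subrK -!scalemxAr [in RHS]mxE [in RHS]mxE.
  by field.
have nonlin : \sum_(i < M) \sum_(j < M) F (at_grid x i j)
    - \sum_(i < M) \sum_(j < M) F (at_grid y i j)
    <= ((x - y)^T *m map2_mx H x y) 0 0.
  rewrite grid_dotE -sumrB; apply: ler_sum => i _.
  rewrite -sumrB; apply: ler_sum => j _.
  by rewrite /at_grid !mxE; exact: F_secant.
rewrite -(grid_dotE (x - y) w) /energy -/h2.
move: quad_w; rewrite -quad mulmxDr [X in _ = 2 * X]mxE.
set A := (x^T *m _ *m _) 0 0; set B := (y^T *m _ *m _) 0 0.
set C := ((x - y)^T *m w) 0 0; set D := (_ *m map2_mx _ _ _) 0 0 in nonlin *.
set P := \sum_(i < M) _ in nonlin *; set Q := \sum_(i < M) _ in nonlin *.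
move=> quad_w.
have -> : h2 * P - 2^-1 * eps ^+ 2 * h2 * A
    - (h2 * Q - 2^-1 * eps ^+ 2 * h2 * B)
  = h2 * (P - Q) - h2 / 2 * (eps ^+ 2 * (A - B)) by field.
have := ler_wpM2l h2_ge0 nonlin.
rewrite quad_w; lra.
Qed.

(** * The dissipation law *)

Theorem theorem2p1 (R : realType) (alpha eps L T : R) (M1 N : nat)
    (t : nat -> R) (u v : nat -> 'cV[R]_(M1 * M1))
    (alpha_gt0 : 0 < alpha) (alpha_lt1 : alpha < 1)
    (eps_gt0 : 0 < eps) (L_gt0 : 0 < L) (M1_gt0 : (0 < M1)%N)
    (t0 : t 0%N = 0) (tN : t N = T)
    (t_incr : forall k : nat, (1 <= k <= N)%N -> t k.-1 < t k)
    (scheme_u : forall n : nat, (1 <= n <= N)%N ->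
       (tau t n)^-1 *: (u n - u n.-1) =
       (tau t n)^-1 *: \sum_(1 <= k < n.+1) a alpha t n (n - k) *: v k)
    (scheme_v : forall n : nat, (1 <= n <= N)%N ->
       v n = eps ^+ 2 *: (Dh L M1 *m (2^-1 *: (u n + u n.-1)))
             - map2_mx H (u n) (u n.-1)) :
  forall n : nat, (1 <= n <= N)%N ->
    (energy_alpha alpha eps L t u v n - energy_alpha alpha eps L t u v n.-1)
      / tau t n
    + (2 * tau t n)^-1
      * (\int[lebesgue_measure]_(s in `[t n.-1, t n]) omega alpha s)
      * (\sum_(i < M1) \sum_(j < M1) mesh L M1 ^+ 2 * at_grid (v n) i j ^+ 2)
    <= 0.
Proof.
case=> // n nN; have tau_gt0 : 0 < tau t n.+1 by rewrite subr_gt0 t_incr.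
have tauV : (tau t n.+1)^-1 != 0 by rewrite invr_eq0 gt_eqF.
have uE := scalerI tauV (scheme_u _ nN).
have := energy_increment (scheme_v _ nN).
rewrite uE /= /energy_alpha /=.
set I := Rintegral _ _ _; set h2 := mesh L M1 ^+ 2.
have h2_ge0 : 0 <= h2 by exact: sqr_ge0.
set E1 := energy _ _ (u n.+1); set E0 := energy _ _ (u n).
set W := \sum_(i < M1) \sum_(j < M1) at_grid (\sum_(1 <= k < _) _) i j * _.
set Q1 := \sum_(i < M1) \sum_(j < M1) \sum_(1 <= k < n.+2) _.
set Q0 := \sum_(i < M1) \sum_(j < M1) \sum_(1 <= k < n.+1) _.
pose V := \sum_(i < M1) \sum_(j < M1) at_grid (v n.+1) i j ^+ 2.
have -> : \sum_(i < M1) \sum_(j < M1) h2 * at_grid (v n.+1) i j ^+ 2 = h2 * V.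
  by rewrite mulr_sumr; apply: eq_bigr => i _; rewrite mulr_sumr.
(* The scalar kernel bound, summed over the grid points. *)
have kernelQ : Q1 - Q0 + I * V <= 2 * W.
  rewrite mulr_sumr -sumrB mulr_sumr -big_split.
  apply: ler_sum => i _.
  rewrite mulr_sumr -sumrB mulr_sumr -big_split.
  apply: ler_sum => j _ /=.
  rewrite [X in 2 * (X * _)](_ : _ =
    \sum_(1 <= k < n.+2) a alpha t n.+1 (n.+1 - k) * at_grid (v k) i j).
    rewrite [X in 2 * X]mulrC [leRHS]mulrA.
    exact: (kernel_bound alpha_gt0 alpha_lt1 t0 t_incr
      (fun k => at_grid (v k) i j) nN).
  by rewrite /at_grid summxE; apply: eq_bigr => k _; rewrite mxE.
move=> dE; have := ler_wpM2l h2_ge0 kernelQ => hQ.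
have -> : (E1 + 2^-1 * h2 * Q1 - (E0 + 2^-1 * h2 * Q0)) / tau t n.+1
    + (2 * tau t n.+1)^-1 * I * (h2 * V)
  = (E1 - E0 + h2 * (Q1 - Q0 + I * V) / 2) / tau t n.+1.
  by field; rewrite gt_eqF.
by rewrite pmulr_lle0 ?invr_gt0//; lra.
Qed.
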